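(* Let $\overline{z}_a=\max_{i\in\{1,\ldots,d_a\}}z_{a,i}$ for any $a\in\mathcal{A}$. Then any prediction rule $\hat{f}\in\mathcal{F}$ that is feasible in the prediction problem $(\mathcal{P})$ and satisfies the upper bound $$\hat{f}(\mathbf{x},\mathbf{Q})\le\sum_{a\in\mathcal{A}}\overline{z}_a x_a\qquad\forall\mathbf{x}\in X,\ \forall\mathbb{Q}\in\mathcal{Q}$$ is weakly optimal ($W$-optimal) in $(\mathcal{P})$.
   Context: Let $n = n_1 + n_2$, $\mathcal{A} = \{1,\ldots,n\}$, and let $X \subseteq \mathbb{Z}^{n_1}\times\mathbb{R}^{n_2}$ be a nonempty linear mixed-integer set (the points of $\mathbb{Z}^{n_1}\times\mathbb{R}^{n_2}$ satisfying a finite system of linear constraints) such that $\mathbf{0}\notin X$ and there is $\mathbf{u}\in\mathbb{R}^n_+$ with $x_a\in[0,u_a]$ for all $a\in\mathcal{A}$ and all $\mathbf{x}\in X$. For each $a\in\mathcal{A}$, the cost $c_a$ takes values in a finite set $\mathcal{S}_a=\{z_{a,1},\ldots,z_{a,d_a}\}$ of $d_a$ strictly positive reals. $\mathcal{Q}_a$ is the set of all probability distributions on $\mathcal{S}_a$. $\mathcal{Q}$ is the set of all probability distributions of $\mathbf{c}=(c_1,\ldots,c_n)^\top$ on $\mathcal{S}_1\times\cdots\times\mathcal{S}_n$; for $\mathbb{Q}\in\mathcal{Q}$, $\mathbb{Q}_a$ is its $a$-th marginal and $\mathbf{Q}=(\mathbb{Q}_1,\ldots,\mathbb{Q}_n)^\top$.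 The expected loss is $f(\mathbf{x},\mathbb{Q})=\mathbb{E}_{\mathbb{Q}}\{\mathbf{c}^\top\mathbf{x}\}=\sum_{a\in\mathcal{A}}\mathbb{E}_{\mathbb{Q}_a}\{c_a\}x_a$. Data: under the nominal distribution $\mathbb{Q}^*\in\mathcal{Q}$, for each $a\in\mathcal{A}$ there are $T_a\in\mathbb{Z}_{>0}$ i.i.d. samples $\widehat{c}_{a,1},\ldots,\widehat{c}_{a,T_a}$ from the marginal $\mathbb{Q}^*_a$; nothing is assumed about the dependence between samples of different components. $\Pr$ is the probability under the law of the data. The empirical marginal distribution $\widehat{\mathbb{Q}}_{a,T_a}\in\mathcal{Q}_a$ gives probability $\frac{1}{T_a}\#\{j:\widehat{c}_{a,j}=z_{a,i}\}$ to $z_{a,i}$, and $\widehat{\mathbf{Q}}=\widehat{\mathbf{Q}}(T_1,\ldots,T_n)=(\widehat{\mathbb{Q}}_{1,T_1},\ldots,\widehat{\mathbb{Q}}_{n,T_n})^\top$. Put $T_{min}=\min_{a\in\mathcal{A}}T_a$. $\mathcal{F}$ is the set of all functions $\hat{f}:X\times\mathcal{Q}_1\times\cdots\times\mathcal{Q}_n\to\mathbb{R}$ (prediction rules). Fix a rate $r>0$. A prediction rule $\hat{f}\in\mathcal{F}$ is feasible in the prediction problem $(\mathcal{P})$ (of minimizing $\hat{f}$ over $\mathcal{F}$ in the pointwise partial order) if $$\limsup_{T_{min}\to+\infty}\frac{1}{T_{min}}\ln\Big(\Pr\{f(\mathbf{x},\mathbb{Q}^* )>\hat{f}(\mathbf{x},\widehat{\mathbf{Q}})\}\Big)\le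 -r\qquad\forall\mathbf{x}\in X,\ \forall\mathbb{Q}^*\in\mathcal{Q},$$ where the limit superior is over all tuples $(T_1,\ldots,T_n)\in\mathbb{Z}_{>0}^n$, i.e. $\lim_{m\to\infty}\sup\{\cdot:\min_aT_a\ge m\}$, with $\ln 0=-\infty$. $\hat{f}\in\mathcal{F}$ is weakly optimal ($W$-optimal) for $(\mathcal{P})$ if it is feasible in $(\mathcal{P})$ and any other prediction rule $\hat{f}'\in\mathcal{F}$ satisfying $\hat{f}'(\mathbf{x},\mathbf{Q})<\hat{f}(\mathbf{x},\mathbf{Q})$ for all $\mathbf{x}\in X$ and all $\mathbb{Q}\in\mathcal{Q}$ is infeasible in $(\mathcal{P})$. *)

(* Defs.v *)
From HB Require Import structures.
From mathcomp Require Import all_boot all_order all_algebra.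
From mathcomp Require Import all_classical all_reals all_analysis.

Set Implicit Arguments.
Unset Strict Implicit.
Unset Printing Implicit Defensive.

Import Order.TTheory GRing.Theory Num.Theory.
Import numFieldNormedType.Exports.

Local Open Scope classical_set_scope.
Local Open Scope ring_scope.

Record fdist (R : realType) (I : finType) := FDist {
  fdist_fun :> {ffun I -> R};
  fdistP : [forall i, 0 <= fdist_fun i] && (\sum_i fdist_fun i == 1)
}.

Definition fprob (R : realType) (I : finType) (p : fdist R I) (E : pred I) : R :=
  \sum_(i | E i) p i.

(* Equality constraints are pairs of opposite inequalities. *)
Definition mixed_integer_linear (R : realType) (n1 n2 : nat)
    (X : set 'cV[R]_(n1 + n2)) : Prop :=
  exists (m : nat) (A : 'M[R]_(m, n1 + n2)) (b : 'cV[R]_m),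
    X = [set x | (forall i, (A *m x) i 0 <= b i 0) /\
                 (forall a : 'I_n1, x (lshift n2 a) 0 \is a Num.int)].

(* The support of the a-th cost is {z a i | i < d a}, with z a injective, so
   the outcomes of a cost vector are identified with vectors of indices. *)
Definition outcome (n : nat) (d : 'I_n -> nat) : finType :=
  {dffun forall a : 'I_n, 'I_(d a)}.

Definition joint (R : realType) (n : nat) (d : 'I_n -> nat) : Type :=
  fdist R (outcome d).

Definition margins (R : realType) (n : nat) (d : 'I_n -> nat) : Type :=
  forall a : 'I_n, fdist R 'I_(d a).

Section Marginal.
Variables (R : realType) (n : nat) (d : 'I_n -> nat).

Definition marginal_fun (Q : joint R d) (a : 'I_n) : {ffun 'I_(d a) -> R} :=
  [ffun i => fprob Q (fun c => c a == i)].

Lemma marginalP (Q : joint R d) (a : 'I_n) :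
  [forall i, 0 <= marginal_fun Q a i] && (\sum_i marginal_fun Q a i == 1).
Proof.
have /andP[/forallP Q0 /eqP Q1] := fdistP Q.
apply/andP; split; first by apply/forallP => i; rewrite ffunE sumr_ge0.
rewrite -Q1 (partition_big (fun c : outcome d => c a) predT) //=.
by apply/eqP/eq_bigr => i _; rewrite ffunE.
Qed.

Definition marginal (Q : joint R d) : margins R d :=
  fun a => FDist (marginalP Q a).

Definition expected_loss (z : forall a : 'I_n, 'I_(d a) -> R)
    (x : 'cV[R]_n) (Q : joint R d) : R :=
  \sum_(c : outcome d) Q c * \sum_a z a (c a) * x a 0.

End Marginal.

Record sample_sizes (n : nat) := SampleSizes {
  sample_size :> 'I_n -> nat;
  sample_size_gt0 : forall a, (0 < sample_size a)%N
}.

(* minn has no neutral element on nat: the iteration starts from the maximum,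
   which does not affect the result when 0 < n. *)
Definition Tmin (n : nat) (T : sample_sizes n) : nat :=
  \big[minn/(\max_(a < n) T a)%N]_(a < n) T a.

(* The sequence of suprema is nonincreasing, so that the limit exists. *)
Definition limsup_Tmin (R : realType) (n : nat) (g : sample_sizes n -> \bar R) :
    \bar R :=
  limn (fun m => ereal_sup [set g T | T in [set T | (m <= Tmin T)%N]]).

Definition data (n : nat) (d : 'I_n -> nat) (T : sample_sizes n) : finType :=
  {dffun forall a : 'I_n, {ffun 'I_(T a) -> 'I_(d a)}}.

Section Empirical.
Variables (R : realType) (n : nat) (d : 'I_n -> nat).

Definition empirical_fun (T : sample_sizes n) (w : data d T) (a : 'I_n) :
    {ffun 'I_(d a) -> R} :=
  [ffun i => #|[pred j | w a j == i]|%:R / (T a)%:R].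

Lemma empiricalP (T : sample_sizes n) (w : data d T) (a : 'I_n) :
  [forall i, 0 <= empirical_fun w a i] && (\sum_i empirical_fun w a i == 1).
Proof.
apply/andP; split; first by apply/forallP => i; rewrite ffunE divr_ge0.
under eq_bigr do rewrite ffunE.
rewrite -mulr_suml -natr_sum.
have -> : (\sum_(i < d a) #|[pred j | w a j == i]| = T a)%N.
  rewrite -[RHS]card_ord -sum1_card (partition_big (w a) predT) //=.
  by apply: eq_bigr => i _; rewrite -sum1_card; apply: eq_bigl => j; rewrite inE.
by rewrite divff // pnatr_eq0 -lt0n sample_size_gt0.
Qed.

Definition empirical (T : sample_sizes n) (w : data d T) : margins R d :=
  fun a => FDist (empiricalP w a).

Definition data_model : Type :=
  joint R d -> forall T : sample_sizes n, fdist R (data d T).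

(* The samples of each component are i.i.d. from the corresponding marginal;
   the coupling of the n components is arbitrary. *)
Definition iid_components (law : data_model) : Prop :=
  forall (Q : joint R d) (T : sample_sizes n) (a : 'I_n)
         (s : {ffun 'I_(T a) -> 'I_(d a)}),
    fprob (law Q T) (fun w => w a == s) = \prod_j marginal Q a (s j).

End Empirical.

Section Prediction.
Variables (R : realType) (n : nat) (d : 'I_n -> nat).
Variable z : forall a : 'I_n, 'I_(d a) -> R.
Variable X : set 'cV[R]_n.

Definition prediction_rule : Type := X -> margins R d -> R.

Definition feasible (law : data_model R d) (r : R) (fhat : prediction_rule) :
    Prop :=
  forall (x : X) (Q : joint R d),
    (limsup_Tmin (fun T : sample_sizes n =>
       ((Tmin T)%:R^-1)%:E *
       lne (fprob (law Q T)
              (fun w => fhat x (empirical R w) <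
                        expected_loss z (\val x) Q))%:E)
     <= (- r)%:E)%E.

Definition weakly_optimal (law : data_model R d) (r : R)
    (fhat : prediction_rule) : Prop :=
  feasible law r fhat /\
  forall fhat' : prediction_rule,
    (forall (x : X) (Q : joint R d),
       fhat' x (marginal Q) < fhat x (marginal Q)) ->
    ~ feasible law r fhat'.

End Prediction.

(* All costs are positive, so the initial value 0 does not affect the maximum. *)
Definition zbar (R : realType) (n : nat) (d : 'I_n -> nat)
    (z : forall a : 'I_n, 'I_(d a) -> R) (a : 'I_n) : R :=
  \big[Num.max/0]_(i < d a) z a i.

(* Main.v *)
(** Let [Q] be the point mass at the vector of the largest costs. Almost surely
    every empirical marginal then coincides with the corresponding marginal of
    [Q], and the expected loss under [Q] is the upper bound on [fhat]. A rule
    that is strictly below [fhat] therefore underestimates this loss with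
    probability one, for all sample sizes, so its rate is 0. *)

Require Import Defs.
From mathcomp Require Import all_boot all_order all_algebra.
From mathcomp Require Import all_classical all_reals all_analysis.
Import Order.TTheory GRing.Theory Num.Theory.
Local Open Scope classical_set_scope.
Local Open Scope ring_scope.

Section FiniteDistributions.
Context {R : realType} {I : finType}.
Implicit Types (p q : fdist R I) (E : pred I) (i : I).

Lemma fdist_ge0 p i : 0 <= p i.
Proof. by have /andP[/forallP] := fdistP p. Qed.

Lemma fdist_sum1 p : \sum_i p i = 1.
Proof. by have /andP[_ /eqP] := fdistP p. Qed.

Lemma fdist_ext p q : p =1 q -> p = q.
Proof.
case: p q => [f fP] [g gP] /= fg; have {}fg : f = g by apply/ffunP.
by case: _ / fg gP => gP; congr FDist; exact: bool_irrelevance.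
Qed.

Lemma le_fprob p E i : E i -> p i <= fprob p E.
Proof.
by move=> Ei; rewrite /fprob (bigD1 i) //= lerDl sumr_ge0// => j _; exact: fdist_ge0.
Qed.

Lemma fprob_eq1 p E i : (forall j, j != i -> p j = 0) -> E i -> fprob p E = 1.
Proof.
move=> p0 Ei; rewrite -(fdist_sum1 p) /fprob (bigD1 i) //= [RHS](bigD1 i) //=.
rewrite big1 => [|j /andP[_ /p0 //]]; rewrite big1 // => j /p0 //.
Qed.

Definition dirac_fun i : {ffun I -> R} := [ffun j => (j == i)%:R].

Lemma dirac_funP i :
  [forall j, 0 <= dirac_fun i j] && (\sum_j dirac_fun i j == 1).
Proof.
apply/andP; split; first by apply/forallP => j; rewrite ffunE.
rewrite (bigD1 i) //= ffunE eqxx big1 ?addr0 // => j /negPf ji.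
by rewrite ffunE ji.
Qed.

Definition dirac_fdist i : fdist R I := FDist (dirac_funP i).

Lemma dirac_fdistE i j : dirac_fdist i j = (j == i)%:R.
Proof. by rewrite ffunE. Qed.

Lemma fprob_dirac i E : fprob (dirac_fdist i) E = (E i)%:R.
Proof.
have di0 j : j != i -> dirac_fdist i j = 0 by rewrite dirac_fdistE => /negPf->.
have [Ei|/negP nEi] := boolP (E i); first exact: (fprob_eq1 _ _ i).
by rewrite /fprob big1 // => j Ej; apply: di0; apply/eqP => ji; rewrite ji in Ej.
Qed.

End FiniteDistributions.

Section PointMass.
Context {R : realType} {n : nat} {d : 'I_n -> nat}.
Implicit Types (c : outcome d) (T : sample_sizes n).

Lemma marginal_dirac c a i : marginal (dirac_fdist c : joint R d) a i = (c a == i)%:R.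
Proof. by rewrite ffunE fprob_dirac. Qed.

Lemma expected_loss_dirac (z : forall a, 'I_(d a) -> R) (x : 'cV[R]_n) c :
  expected_loss z x (dirac_fdist c) = \sum_a z a (c a) * x a 0.
Proof.
rewrite /expected_loss (bigD1 c) //= dirac_fdistE eqxx mul1r [X in _ + X]big1 ?addr0 //.
by move=> c' /negPf cc'; rewrite dirac_fdistE cc' mul0r.
Qed.

Definition constant_data T c : data d T := [ffun a => [ffun=> c a]].

(** Each observed frequency is [T a / T a] or [0 / T a], and [T a] is positive. *)
Lemma empirical_constant T c :
  empirical R (constant_data T c) = marginal (dirac_fdist c).
Proof.
apply: functional_extensionality_dep => a; apply: fdist_ext => i.
rewrite marginal_dirac ffunE (eq_card (B := fun=> c a == i)); last first.
  by move=> j; rewrite !inE !ffunE.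
case: (c a == i); last by rewrite eq_card0 ?mul0r.
by rewrite eq_cardT // size_enum_ord divff // pnatr_eq0 -lt0n sample_size_gt0.
Qed.

(** Some draw [w a j] differs from [c a]. The coupling of the components is unknown, so the mass of
    [w] is bounded by the probability that component [a] equals [w a]; this is a product whose
    factor at [j] vanishes. *)
Lemma law_dirac (law : data_model R d) T c w :
  iid_components law -> w != constant_data T c -> law (dirac_fdist c) T w = 0.
Proof.
move=> iid wc; have /existsP[a /existsP[j wacj]] :
    [exists a, [exists j, w a j != c a]].
  apply: contraR wc; rewrite negb_exists => /forallP wc.
  apply/eqP/ffunP => a; apply/ffunP => j; rewrite !ffunE.
  by have := wc a; rewrite negb_exists => /forallP/(_ j)/negPn/eqP.
apply/eqP; rewrite eq_le fdist_ge0 andbT.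
apply: (@le_trans _ _ (fprob (law (dirac_fdist c) T) (fun w' => w' a == w a))).
  exact: le_fprob.
by rewrite iid (bigD1 j) //= marginal_dirac eq_sym (negPf wacj) mul0r.
Qed.

End PointMass.

(** The support is nonempty and lies above the initial value 0 of the maximum, so 0 cannot win. *)
Lemma zbar_attained {R : realType} {n : nat} {d : 'I_n -> nat}
    (z : forall a, 'I_(d a) -> R) a :
  (0 < d a)%N -> (forall i, 0 < z a i) -> exists i, zbar z a = z a i.
Proof.
move=> da_gt0 z_gt0; exists [arg max_(i > Ordinal da_gt0) z a i]%O.
by apply: bigmax_eq_arg => // i _; exact: ltW.
Qed.

(** Every supremum ranges over a nonempty set of sample sizes. For [n = 0], [Tmin] is 0 and the sets
    with [m > 0] would be empty. *)
Lemma limsup_Tmin_ge {R : realType} {n : nat} (g : sample_sizes n -> \bar R) l :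
  (0 < n)%N -> (forall T, l <= g T)%E -> (l <= limsup_Tmin g)%E.
Proof.
move=> n_gt0 g_ge; apply: lime_ge.
  apply: ereal_nonincreasing_is_cvgn => m m' mm'; apply: le_ereal_sup.
  by move=> _ [T /= m'T <-]; exists T => //=; exact: leq_trans m'T.
(* The common size [m.+1] is positive even for [m = 0]. *)
apply: nearW => m; pose T := @SampleSizes n (fun=> m.+1) (fun=> ltn0Sn m).
apply: le_trans (g_ge T) _; apply: ereal_sup_ubound; exists T => //=.
(* The initial value of the minimum must also be at least [m]; it is a maximum over a nonempty index
   set. *)
rewrite /Tmin; elim/big_ind: _ => //= [|k k' mk mk']; last by rewrite leq_min mk.
by apply: leq_trans (leq_bigmax (Ordinal n_gt0)); exact: leqnSn.
Qed.

Theorem proposition3 (R : realType) (n1 n2 : nat)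
    (X : set 'cV[R]_(n1 + n2)) (u : 'I_(n1 + n2) -> R)
    (d : 'I_(n1 + n2) -> nat) (z : forall a : 'I_(n1 + n2), 'I_(d a) -> R)
    (law : data_model R d) (r : R) (fhat : prediction_rule d X)
    (X_milp : mixed_integer_linear X)
    (X_nonempty : X !=set0)
    (X_not0 : ~ X 0)
    (u_ge0 : forall a, 0 <= u a)
    (X_bounded : forall x, X x -> forall a, 0 <= x a 0 <= u a)
    (d_gt0 : forall a, (0 < d a)%N)
    (z_inj : forall a, injective (z a))
    (z_gt0 : forall a i, 0 < z a i)
    (law_iid : iid_components law)
    (r_gt0 : 0 < r)
    (fhat_feasible : feasible z law r fhat)
    (fhat_le : forall (x : X) (Q : joint R d),
       fhat x (marginal Q) <= \sum_a zbar z a * (\val x) a 0) :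
  weakly_optimal z law r fhat.
Proof.
split=> // fhat' fhat'_lt fhat'_feasible.
have [x0 Xx0] := X_nonempty; pose x : X := exist _ x0 (mem_set Xx0).
(* In dimension 0 the only vector is 0, which [X] excludes. *)
have n_gt0 : (0 < n1 + n2)%N.
  rewrite lt0n; apply/eqP => n0; apply: X_not0.
  rewrite (_ : 0 = x0) //; apply/matrixP => a.
  by have : (a < 0)%N by rewrite -n0.
have zbarP a : {i | zbar z a = z a i} by apply: cid; exact: zbar_attained.
pose c : outcome d := [ffun a => sval (zbarP a)].
pose Q : joint R d := dirac_fdist c.
have lossE : expected_loss z x0 Q = \sum_a zbar z a * x0 a 0.
  by rewrite expected_loss_dirac; apply: eq_bigr => a _; rewrite ffunE -(svalP (zbarP a)).
(* As [- r < 0], a limit superior of at least 0 at [x] and [Q] refutes feasibility. *)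
have := fhat'_feasible x Q; apply/negP; rewrite -ltNge.
apply: (@lt_le_trans _ _ 0%E); first by rewrite lte_fin oppr_lt0.
(* All the mass sits on the constant data, so it suffices that [fhat'] underestimates the loss
   there: the event then has probability 1 and logarithm 0. *)
apply: limsup_Tmin_ge => // T; rewrite (fprob_eq1 _ _ (constant_data T c)).
- by rewrite lne1 mule0.
- by move=> w; exact: law_dirac.
- by rewrite empirical_constant lossE; exact: lt_le_trans (fhat'_lt x Q) (fhat_le x Q).
Qed.
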